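(* Let $q\in\mathbb N$, $q\ge 3$, and let $(r_i)_{i\ge1}$ be a sequence with $r_i>0$, $r_i\to0$ and $\sum_i r_i=\infty$. Then there exist an $a>\frac14$ and a real sequence $(a_i)_{i\ge1}$ such that - $a_i\to a$ as $i\to\infty$; - $a_i=a$ whenever $i\not\equiv 1,2\pmod q$; - $a_{qi+1}-a=O(r_i)$ and $a_{qi+2}-a=O(r_i)$ as $i\to\infty$; and the continued fraction $$\frac{-a_1}{1-\frac{a_2}{1-\frac{a_3}{1-\dots}}}$$ converges.
   Context: For any $b\in\mathbb R$ put $T_b(z)=-\frac{b}{z+1}$. The $n$-th subsequent ratio (approximant) $p_n/q_n$ of the continued fraction with real coefficients $a_1,a_2,\dots$ is $$\tau_n=T_{a_1}\circ T_{a_2}\circ\dots\circ T_{a_n}(0)\in\mathbb R\cup\{\infty\}.$$ The continued fraction converges if the sequence $(\tau_n)_{n\ge1}$ converges in $\mathbb R\cup\{\infty\}$, the boundary $\partial H$ of the closed upper half-plane $H=\{\operatorname{Im} z\ge 0\}\cup\{\infty\}$ in the Riemann sphere. *)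

(* Defs.v *)
From HB Require Import structures.
From mathcomp Require Import all_boot all_order all_algebra.
From mathcomp Require Import all_classical all_reals all_analysis.

Set Implicit Arguments.
Unset Strict Implicit.
Unset Printing Implicit Defensive.

Import Order.TTheory GRing.Theory Num.Theory.
Import numFieldNormedType.Exports.

Local Open Scope classical_set_scope.
Local Open Scope ring_scope.

(* R together with one point at infinity ([None]), with its circle topology,
   i.e. the boundary of the upper half-plane in the Riemann sphere. *)
Notation extR R := (one_point_compactification R).

(* z |-> - b / (z + 1) on R together with infinity.  This is a bijection when
   b <> 0; for b = 0 the value at z = -1 (formally 0 / 0) is not meaningful. *)
Definition T (R : realType) (b : R) (z : extR R) : extR R :=
  if z is Some x then
    if x + 1 == 0 then None else Some (- (b / (x + 1)))
  else Some 0.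

(* T (a 1) (T (a 2) (... (T (a n) 0))); the value [a 0] is not used. *)
Definition approximant (R : realType) (a : nat -> R) (n : nat) : extR R :=
  foldr (fun i => T (a i)) (Some 0) (iota 1 n).

Definition cf_converges (R : realType) (a : nat -> R) : Prop :=
  exists l : extR R, approximant a n @[n --> \oo] --> l.

(* Main.v *)
(* Take [a = 1 / (4 cos^2 (pi / q))], so that [T a] is elliptic of order [q],
   and [a_ (q i + 1) = a_ (q i + 2) = a (1 + r i)].  In the coordinate [1 / z], the
   [i]-th block of [q] consecutive maps is then the translation by
   [r i / ((1 + r i) a)].  The sum of these translations diverges, so the
   approximants, being images under the first blocks of points that are either
   [0] or bounded in the coordinate [1 / z], converge to [0]. *)

Require Import Defs.
From mathcomp Require Import all_boot all_order all_algebra.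
From mathcomp Require Import all_classical all_reals all_analysis.
From mathcomp Require Import ring lra zify.

Import Order.TTheory GRing.Theory Num.Theory.
Import numFieldNormedType.Exports.

Local Open Scope classical_set_scope.
Local Open Scope ring_scope.

(** * Homogeneous coordinates on the extended line *)

Definition proj {R : realType} (v : R * R) : extR R :=
  if v.2 == 0 then None else Some (v.1 / v.2).

Definition lift_T {R : realType} (b : R) (v : R * R) : R * R :=
  (- (b * v.2), v.1 + v.2).

(** For nonzero [k], this acts on the coordinate [1 / z] as the translation by [s]; [k] only
    rescales the representative. *)
Definition scaled_shear {R : realType} (k s : R) (v : R * R) : R * R :=
  (k * v.1, k * (v.2 + s * v.1)).

Lemma lift_T_eq0 (R : realType) (b : R) (v : R * R) :
  b != 0 -> lift_T b v = 0 -> v = 0.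
Proof.
case: v => x y b0 [/= /eqP]; rewrite oppr_eq0 mulf_eq0 (negbTE b0) /=.
by move=> /eqP ->; rewrite addr0 => ->.
Qed.

Lemma T_proj (R : realType) (b : R) (v : R * R) :
  v != 0 -> T b (proj v) = proj (lift_T b v).
Proof.
case: v => x y; rewrite /T /proj /=; have [->|y0] := eqVneq y 0.
  move=> v0; rewrite addr0 mulr0 oppr0 mul0r; case: eqP => // x0.
  by rewrite x0 eqxx in v0.
move=> _; have -> : x / y + 1 = (x + y) / y by field.
rewrite mulf_eq0 invr_eq0 (negbTE y0) orbF; case: eqVneq => // xy0.
by congr Some; field; rewrite xy0 y0.
Qed.

Lemma proj_scaled_shear (R : realType) (k s x y : R) :
  k != 0 -> proj (scaled_shear k s (x, y)) = proj (x, y + s * x).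
Proof.
move=> k0; rewrite /proj /= mulf_eq0 (negbTE k0) /=; case: eqVneq => // d0.
by congr Some; field; rewrite d0 k0.
Qed.

Lemma scaled_shearM (R : realType) (k l s t : R) (v : R * R) :
  scaled_shear k s (scaled_shear l t v) = scaled_shear (k * l) (s + t) v.
Proof. by rewrite /scaled_shear /=; congr pair; ring. Qed.

Lemma approximant_proj (R : realType) (b : nat -> R) (n : nat) :
  (forall i, (1 <= i)%N -> b i != 0) ->
  approximant b n = proj (foldr (fun i => lift_T (b i)) (0, 1) (iota 1 n)).
Proof.
(* [proj (0, 0)] is the junk value [None], so the induction also carries [v != 0], which nonzero
   coefficients preserve. *)
move=> b0; suff : forall s, all (leq 1) s ->
    let v := foldr (fun i => lift_T (b i)) (0, 1) s in
    v != 0 /\ foldr (fun i => T (b i)) (Some 0) s = proj v.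
  move=> /(_ (iota 1 n)) [|//]; apply/allP => i.
  by rewrite mem_iota => /andP[].
elim=> [_|i s IH /= /andP[i1 /IH[v0 ->]]] /=.
  rewrite /proj /= oner_eq0 mul0r; split => //.
  by apply/eqP => -[] /eqP; rewrite oner_eq0.
split; last exact: T_proj.
by apply: contra_neq v0; apply: lift_T_eq0; exact: b0.
Qed.

(** * Elliptic maps of finite order *)

(* [lift_T a] has determinant [a = rho^2] and trace [1 = 2 rho cos t], so it is
   [rho] times a matrix conjugate to the rotation by [t]. *)
Lemma iter_lift_T (R : realType) (t rho : R) (n : nat) (x y : R) :
  2 * rho * cos t = 1 ->
  (sin t * (iter n (lift_T (rho ^+ 2)) (x, y)).1 =
   rho ^+ n * (sin (n%:R * t) * (- rho * y - cos t * x)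
               + cos (n%:R * t) * sin t * x)) /\
  (sin t * (iter n (lift_T (rho ^+ 2)) (x, y)).2 =
   rho ^+ n * (sin (n%:R * t) * (2 * cos t * x + cos t * y)
               + cos (n%:R * t) * sin t * y)).
Proof.
move=> rc; have cs : cos t ^+ 2 + sin t ^+ 2 = 1 := cos2Dsin2 t.
elim: n => [|n [IH1 IH2]].
  by rewrite !mul0r sin0 cos0 expr0 /=; split; ring.
rewrite iterS /lift_T /=; set X := (iter _ _ _).1 in IH1 *.
set Y := (iter _ _ _).2 in IH2 *.
rewrite -natr1 mulrDl mul1r sinD cosD (exprS rho n).
have -> : sin t * - (rho ^+ 2 * Y) = - rho ^+ 2 * (sin t * Y) by ring.
have -> : sin t * (X + Y) = sin t * X + sin t * Y by ring.
rewrite IH1 IH2; set E := rho ^+ n; set S := sin (_ * _); set C := cos (_ * _).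
move: rc cs; set c := cos t; set s := sin t => rc cs.
split; apply/eqP; rewrite -subr_eq0; apply/eqP.
  (* Both differences are combinations of [c ^+ 2 + s ^+ 2 - 1] and [2 * rho * c - 1], which
     vanish. *)
  transitivity (E * rho * S * x * ((c ^+ 2 + s ^+ 2 - 1) - (2 * rho * c - 1))).
    by ring.
  by rewrite rc cs !subrr mulr0.
transitivity (E * (rho * S * y * (c ^+ 2 + s ^+ 2 - 1)
                   - (c * S + s * C) * (x + y) * (2 * rho * c - 1))).
  by ring.
by rewrite rc cs !subrr !mulr0 subrr mulr0.
Qed.

(** For [t = pi / q] and [rho = 1 / (2 cos t)], the [q]-th iterate is conjugate to [rho ^+ q] times
    the rotation by [pi], hence is the scalar [- rho ^+ q]. The bound on [a = rho ^+ 2] amounts to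
    [cos t ^+ 2 < 1]; [q >= 3] makes [cos t] positive. *)
Lemma exists_elliptic_of_order (R : realType) (q : nat) : (3 <= q)%N ->
  exists a k : R, 4^-1 < a /\ k != 0 /\
    forall v, iter q (lift_T a) v = (k * v.1, k * v.2).
Proof.
move=> q3; pose t : R := pi / q%:R.
have q0 : (0 : R) < q%:R by rewrite ltr0n; lia.
have q2 : (2 : R) < q%:R by rewrite ltr_nat.
have t0 : 0 < t by rewrite divr_gt0 ?pi_gt0.
have tpi2 : t < pi / 2 by rewrite ltr_pM2l ?pi_gt0 // ltf_pV2 ?posrE.
have s0 : 0 < sin t.
  by rewrite sin_gt0_pi // t0 /=; have := pi_gt0 R; lra.
have c0 : 0 < cos t.
  by rewrite cos_gt0_pihalf // tpi2 andbT; have := pi_gt0 R; lra.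
have qt : q%:R * t = pi by rewrite /t mulrC divfK // gt_eqF.
pose rho := (2 * cos t)^-1.
have rc : 2 * rho * cos t = 1 by rewrite /rho; field; rewrite gt_eqF.
have rho0 : 0 < rho by rewrite invr_gt0 mulr_gt0.
exists (rho ^+ 2), (- rho ^+ q); split; last split.
- have c1 : cos t ^+ 2 < 1.
    by rewrite -(cos2Dsin2 t) ltrDl exprn_gt0.
  have -> : 4^-1 = rho ^+ 2 * cos t ^+ 2.
    by rewrite /rho; field; rewrite gt_eqF.
  by rewrite -[ltRHS]mulr1 ltr_pM2l // exprn_gt0.
- by rewrite oppr_eq0 expf_neq0 // gt_eqF.
- move=> [x y]; have [] := @iter_lift_T R t rho q x y rc.
  rewrite qt sinpi cospi; case: (iter _ _ _) => X Y /= EX EY.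
  have sN0 : sin t != 0 by rewrite gt_eqF.
  by congr pair; apply: (mulfI sN0); rewrite ?EX ?EY; ring.
Qed.

(** * Perturbed coefficients, block by block *)

Definition cf_coef {R : realType} (a : R) (q : nat) (e : nat -> R)
    (m : nat) : R :=
  if (m %% q == 1)%N || (m %% q == 2)%N then a * (1 + e (m %/ q)%N) else a.

Lemma cf_coef12 (R : realType) (a : R) (q : nat) (e : nat -> R) (n j : nat) :
  (3 <= q)%N -> (1 <= j <= 2)%N -> cf_coef a q e (q * n + j) = a * (1 + e n).
Proof.
move=> q3 j12; rewrite /cf_coef mulnC modnMDl divnMDl; last lia.
rewrite modn_small ?divn_small ?addn0; try lia.
by case: ifP => // /negbT; lia.
Qed.

(** For [j = q] the quotient is already [n.+1], but residue 0 is unperturbed, so block [n] may run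
    from [q * n + 1] to [q * n + q]. *)
Lemma cf_coef_ge3 (R : realType) (a : R) (q : nat) (e : nat -> R) (n j : nat) :
  (3 <= j <= q)%N -> cf_coef a q e (q * n + j) = a.
Proof.
move=> /andP[j3]; rewrite /cf_coef mulnC modnMDl leq_eqVlt => /orP[/eqP ->|jq].
  by rewrite modnn.
by rewrite modn_small //; case: ifP => // /orP[] /eqP; lia.
Qed.

Lemma foldr_const (I T : Type) (f : I -> T -> T) (g : T -> T) (P : pred I) v s :
  (forall i, P i -> f i =1 g) -> all P s -> foldr f v s = iter (size s) g v.
Proof. by move=> fg; elim: s => //= i s IH /andP[/fg -> /IH ->]. Qed.

(* Inverting [z], the two perturbed maps amount to the composition of [T a]
   twice with the translation by [e / ((1 + e) a)]. *)
Lemma lift_T2 (R : realType) (a e : R) (v : R * R) : a != 0 -> 1 + e != 0 ->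
  lift_T (a * (1 + e)) (lift_T (a * (1 + e)) v) =
  scaled_shear (1 + e) (e / ((1 + e) * a)) (lift_T a (lift_T a v)).
Proof.
case: v => x y a0 e0; rewrite /lift_T /scaled_shear /=.
by congr pair; field; rewrite ?a0 ?e0.
Qed.

(** The perturbed maps are the two outermost ones of the block, so [lift_T2] pulls the perturbation
    out as a left factor. This serves full blocks and also unfinished ones with at least two
    maps. *)
Lemma cf_coef_block (R : realType) (a : R) (q : nat) (e : nat -> R) (n j : nat)
    (v : R * R) :
  (j.+2 <= q)%N -> (3 <= q)%N -> a != 0 -> 1 + e n != 0 ->
  foldr (fun i => lift_T (cf_coef a q e i)) v (iota (1 + q * n) j.+2) =
  scaled_shear (1 + e n) (e n / ((1 + e n) * a)) (iter j.+2 (lift_T a) v).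
Proof.
move=> jq q3 a0 e0.
have -> : iota (1 + q * n) j.+2 =
    [:: q * n + 1, q * n + 2 & map (addn (q * n)) (iota 3 j)]%N.
  by rewrite -iotaDl /= !addnS addn0.
rewrite /= foldr_map (@foldr_const _ _ _ (lift_T a) (fun i => 3 <= i <= q)%N).
- by rewrite size_iota !cf_coef12 // lift_T2.
- by move=> i iq w; rewrite cf_coef_ge3.
- by apply/allP => i; rewrite mem_iota; lia.
Qed.

(** Unperturbed, a full block is the scalar [k], so each perturbed one is a scaled shear, and
    composing shears adds their shifts. *)
Lemma cf_coef_blocks (R : realType) (a k : R) (q : nat) (e : nat -> R)
    (n : nat) :
  (3 <= q)%N -> a != 0 -> k != 0 -> (forall i, 1 + e i != 0) ->
  (forall v, iter q (lift_T a) v = (k * v.1, k * v.2)) ->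
  exists2 l : R, l != 0 & forall v,
    foldr (fun i => lift_T (cf_coef a q e i)) v (iota 1 (q * n)) =
    scaled_shear l (\sum_(i < n) e i / ((1 + e i) * a)) v.
Proof.
move=> q3 a0 k0 e0 hq; elim: n => [|n [l l0 IH]].
  exists 1; first exact: oner_neq0.
  by case=> x y; rewrite muln0 big_ord0 /scaled_shear /= mul0r addr0 !mul1r.
exists (l * (1 + e n) * k) => [|v]; first by rewrite !mulf_neq0.
rewrite mulnS addnC iotaD foldr_cat IH.
have [j qE] : exists j, q = j.+2 by exists q.-2; lia.
rewrite {3}qE cf_coef_block -?qE // hq scaled_shearM big_ord_recr /=.
by rewrite /scaled_shear /=; congr pair; ring.
Qed.

(** The full blocks translate [1 / z] by [s]. The fewer than [q] remaining maps send 0 either to 0,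
    which shears fix, or to a point with [1 / z >= - B]; the final [1 / z] is then at least
    [s - B]. *)
Lemma approximant_bound (R : realType) (a k : R) (q : nat) (e : nat -> R) :
  (3 <= q)%N -> 0 < a -> k != 0 -> (forall i, 0 <= e i) ->
  (forall v, iter q (lift_T a) v = (k * v.1, k * v.2)) ->
  exists B : R, forall m,
    let s := \sum_(i < (m %/ q)%N) e i / ((1 + e i) * a) in
    B < s -> exists2 x : R, approximant (cf_coef a q e) m = Some x &
                            `|x| <= (s - B)^-1.
Proof.
move=> q3 a0 k0 e_ge0 hq.
have aN0 : a != 0 by rewrite gt_eqF.
have e1 i : 1 + e i != 0 by rewrite gt_eqF // ltr_wpDr.
have coef_neq0 i : (1 <= i)%N -> cf_coef a q e i != 0.
  by move=> _; rewrite /cf_coef; case: ifP => _ //; rewrite mulf_neq0.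
have shift_ge0 i : 0 <= e i / ((1 + e i) * a).
  by rewrite !(divr_ge0, mulr_ge0, addr_ge0) // ltW.
have shift_le i : e i / ((1 + e i) * a) <= a^-1.
  rewrite invfM mulrA -[leRHS]mul1r ler_pM2r ?invr_gt0 //.
  by rewrite ler_pdivrMr ?mul1r ?lerDr // ltr_wpDr.
pose w j := iter j (lift_T a) (0, 1).
(* Bounds [1 / z] on the unperturbed orbit of 0. Where [(w j).1 = 0] the quotient is 0 by
   convention; that point is [z = 0], treated separately. *)
pose D := \sum_(j < q) `|(w j).2 / (w j).1|.
have D_ge j : (j < q)%N -> `|(w j).2 / (w j).1| <= D.
  move=> jq; rewrite /D (bigD1 (Ordinal jq)) //= lerDl; exact: sumr_ge0.
have D0 : 0 <= D by exact: sumr_ge0.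
(* [a^-1] accounts for the shift of the unfinished block, [D] for the unperturbed orbit. *)
exists (a^-1 + D) => m s Bs.
have [l l0 blocks] := @cf_coef_blocks R a k q e (m %/ q) q3 aN0 k0 e1 hq.
have q0 : (0 < q)%N by lia.
rewrite approximant_proj // (divn_eq m q) iotaD foldr_cat (mulnC _ q) blocks -/s.
have close (x y : R) : x != 0 -> `|y / x| <= a^-1 + D ->
    exists2 z : R, proj (scaled_shear l s (x, y)) = Some z &
                   `|z| <= (s - (a^-1 + D))^-1.
  move=> x0; rewrite ler_norml => /andP[yx _].
  have sB : 0 < s - (a^-1 + D) by rewrite subr_gt0.
  have ys : 0 < y / x + s by lra.
  rewrite proj_scaled_shear // /proj /=.
  have -> : y + s * x = (y / x + s) * x by field.
  rewrite mulf_eq0 (negbTE x0) (gt_eqF ys) /=; eexists; first by [].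
  rewrite invfM mulrCA divff // mulr1.
  rewrite normfV gtr0_norm // lef_pV2 ?posrE //; lra.
(* Split on the length of the unfinished block: with a single map [lift_T2] does not apply, and
   [1 / z] is computed directly. *)
move: (m %% q)%N (ltn_pmod m q0) => [|[|j]] jq.
- rewrite proj_scaled_shear // /proj /= mulr0 addr0 oner_eq0 mul0r.
  by exists 0 => //; rewrite normr0 invr_ge0 subr_ge0 ltW.
- have := @cf_coef12 R a q e (m %/ q)%N 1 q3 isT; rewrite addn1 => E1.
  rewrite /= E1 /lift_T /= mulr1 add0r; apply: close.
    by rewrite oppr_eq0 mulf_neq0.
  rewrite div1r invrN normrN ger0_norm; last first.
    by rewrite invr_ge0 mulr_ge0 ?ltW // ltr_wpDr.
  rewrite -[leLHS]addr0 lerD //.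
  rewrite invfM -[leRHS]mulr1 ler_pM2l ?invr_gt0 //.
  by rewrite invf_le1 ?lerDl // ltr_wpDr.
- rewrite cf_coef_block ?(ltnW jq) // -/(w j.+2).
  have wN0 : w j.+2 != 0.
    elim: j.+2 => [|i IH]; first by apply/eqP => -[/eqP]; rewrite oner_eq0.
    by apply: contra_neq IH; apply: lift_T_eq0.
  have := D_ge _ jq; move: wN0; case: (w j.+2) => X Y wN0 /= YX.
  rewrite /(scaled_shear (1 + _)) /=.
  have [X0|X0] := eqVneq X 0.
    rewrite X0 !mulr0 addr0 proj_scaled_shear // /proj /= mulr0 addr0 mul0r.
    have Y0 : Y != 0 by apply: contra_neq wN0 => ->; rewrite X0.
    rewrite mulf_eq0 (negbTE (e1 _)) (negbTE Y0) /=.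
    by exists 0 => //; rewrite normr0 invr_ge0 subr_ge0 ltW.
  apply: close; first by rewrite mulf_neq0.
  set c := e _ / _.
  have -> : (1 + e (m %/ q)%N) * (Y + c * X) / ((1 + e (m %/ q)%N) * X) =
            c + Y / X.
    by field; rewrite ?e1 ?X0.
  apply: le_trans (ler_normD _ _) _; rewrite lerD //.
  by rewrite ger0_norm /c.
Qed.

Lemma cvg_divn (q : nat) : (0 < q)%N -> (m %/ q)%N @[m --> \oo] --> \oo.
Proof.
move=> q0 P [N _ NP]; exists (N * q)%N => // m /= Nm; apply: NP => /=.
by rewrite leq_divRL.
Qed.

(* The sequences are indexed by i >= 1; their values at 0 are irrelevant.
   The partial numerators are required to be nonzero, so that every T (a_ i)
   is a Moebius transformation of the extended line: otherwise a_ 1 = 0 would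
   make the continued fraction degenerate to the constant 0. *)
Theorem theorem1p2 (R : realType) (q : nat) (r : nat -> R) :
  (3 <= q)%N ->
  (forall i : nat, (1 <= i)%N -> 0 < r i) ->
  r i @[i --> \oo] --> (0 : R) ->
  (\sum_(1 <= i < n) r i) @[n --> \oo] --> +oo ->
  exists (a : R) (a_ : nat -> R),
    4^-1 < a /\
    (forall i : nat, (1 <= i)%N -> a_ i != 0) /\
    a_ i @[i --> \oo] --> a /\
    (forall i : nat, (1 <= i)%N ->
       i != 1 %[mod q] -> i != 2 %[mod q] -> a_ i = a) /\
    (fun i : nat => a_ (q * i + 1)%N - a) =O_\oo r /\
    (fun i : nat => a_ (q * i + 2)%N - a) =O_\oo r /\
    cf_converges a_.
Proof.
move=> q3 r_gt0 r_cvg r_sum.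
have [a [k [a4 [k0 hq]]]] := @exists_elliptic_of_order R q q3.
have a0 : 0 < a by apply: le_lt_trans a4.
have q0 : (0 < q)%N by lia.
(* [r 0] may have any sign; the value 0 keeps every [1 + e i] positive. *)
pose e i : R := if i is 0%N then 0 else r i.
have e_ge0 i : 0 <= e i by case: i => //= i; rewrite ltW // r_gt0.
have e_cvg : e i @[i --> \oo] --> (0 : R).
  apply: cvg_trans r_cvg; apply: near_eq_cvg; exists 1%N => // -[|i] //.
have bigO_shift (f : nat -> R) :
    (forall i, f i = a * (1 + e i) - a) -> f =O_\oo r.
  move=> fE; apply/eqO_exP; exists a => //; exists 1%N => // -[//|i] _ /=.
  rewrite fE (_ : _ - _ = a * r i.+1) /=; last by ring.
  by rewrite normrM (gtr0_norm a0).
exists a, (cf_coef a q e); split => //.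
split; last split; last split; last split; last split.
- move=> i _; rewrite /cf_coef; case: ifP => _; last by rewrite gt_eqF.
  by rewrite mulf_neq0 ?gt_eqF // ltr_wpDr.
- apply/cvgrPdist_le => eps eps0.
  have ea : 0 < eps / a by rewrite divr_gt0.
  have e_div : e (m %/ q)%N @[m --> \oo] --> (0 : R).
    exact: cvg_comp (@cvg_divn q q0) e_cvg.
  move/cvgrPdist_le : e_div => /(_ _ ea); apply: filterS => m.
  rewrite sub0r normrN ger0_norm // ler_pdivlMr // /cf_coef => em.
  case: ifP => _; last by rewrite subrr normr0 ltW.
  rewrite (_ : a - _ = - (e (m %/ q)%N * a)); last by ring.
  by rewrite normrN ger0_norm // mulr_ge0 // ltW.
- move=> i _; rewrite /cf_coef (@modn_small 1 q) ?(ltnW q3) //.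
  rewrite (@modn_small 2 q) //.
  by move=> /negbTE -> /negbTE ->.
- by apply: bigO_shift => i; rewrite cf_coef12.
- by apply: bigO_shift => i; rewrite cf_coef12.
- have [B hB] := @approximant_bound R a k q e q3 a0 k0 e_ge0 hq.
  pose s n := \sum_(i < n) e i / ((1 + e i) * a).
  (* A convergent [e] is bounded by some [M], so for [i >= 1] each shift is at least
     [r i / ((1 + M) * a)], and divergence passes from [r] to [s]. *)
  have s_cvg : s n @[n --> \oo] --> +oo.
    have /cvg_seq_bounded/pinfty_ex_gt0[M M0 /= eN] : cvgn e.
      by apply/cvg_ex; exists 0.
    have eM i : e i <= M by apply: le_trans (eN i I); exact: ler_norm.
    have M1 : 0 < (1 + M) * a by rewrite mulr_gt0 // addr_gt0.
    apply/cvgryPge => A; move/cvgryPge : r_sum => /(_ (A * ((1 + M) * a))).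
    apply: filterS => n; rewrite -ler_pdivlMr // => /le_trans; apply.
    rewrite /s; case: n => [|n]; first by rewrite big_geq // mul0r big_ord0.
    rewrite -(big_mkord xpredT (fun i => e i / ((1 + e i) * a))) big_ltn //=.
    rewrite mul0r add0r mulr_suml; apply: ler_sum_nat => -[//|i] _.
    rewrite ler_pM2l ?r_gt0 // lef_pV2 ?posrE ?mulr_gt0 ?ltr_wpDr ?(ltW M0)
            ?(e_ge0 i.+1) //.
    by rewrite ler_pM2r // lerD2l; exact: (eM i.+1).
  have s_div : s (m %/ q)%N @[m --> \oo] --> +oo.
    exact: cvg_comp (@cvg_divn q q0) s_cvg.
  exists (Some 0) => P; rewrite /= -[nbhs _ _]/(nbhs (0 : R) (Some @^-1` P)).
  move=> /nbhs_ballP[eps /= eps0 epsP].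
  (* Beyond this threshold [(s (m %/ q) - B)^-1 < eps]. *)
  move/cvgryPgt : s_div => /(_ (B + eps^-1)); apply: filterS => m.
  rewrite /= -ltrBrDl => Bs.
  have sB : 0 < s (m %/ q)%N - B by apply: lt_trans Bs; rewrite invr_gt0.
  have [|x -> xs] := hB m; first by rewrite -subr_gt0.
  apply: epsP; rewrite /ball /= sub0r normrN; apply: le_lt_trans xs _.
  by rewrite invf_plt ?posrE.
Qed.
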